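(* For any $m,n,p \in \mathbb{N}$ such that $p \leq m$ and for any sequence $(x_i)_{i\in\mathbb{Z}}$ of complex numbers, we have $$\Delta^{m} x_{n} = \sum_{j=0}^{p}(-1)^{j}\binom{p}{j}\, \Delta^{m-p} x_{n-j}.$$
   Context: $\mathbb{N}=\{0,1,2,\dots\}$. For a sequence $(x_i)_{i\in\mathbb{Z}}$, the $m$-th difference $\Delta^m x_n$ is defined recursively by $\Delta^0 x_i = x_i$ for all $i\in\mathbb{Z}$ and $\Delta^{m} x_{n} = \Delta^{m-1} x_{n} - \Delta^{m-1} x_{n-1}$ for $m\geq 1$. *)

(* Defs.v *)
From mathcomp Require Import all_boot all_order all_algebra.

Set Implicit Arguments.
Unset Strict Implicit.
Unset Printing Implicit Defensive.

Import GRing.Theory.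
Local Open Scope ring_scope.

(* [bdiff m x i] is the m-th backward difference of x at index i. *)
Fixpoint bdiff (V : zmodType) (m : nat) (x : int -> V) (i : int) : V :=
  if m is m'.+1 then bdiff m' x i - bdiff m' x (i - 1) else x i.

(* Main.v *)
Require Import Defs.
From mathcomp Require Import all_boot all_order all_algebra.
From mathcomp Require Import reals complex.

Set Implicit Arguments.
Unset Strict Implicit.
Unset Printing Implicit Defensive.

Import GRing.Theory.
Local Open Scope ring_scope.
Local Open Scope complex_scope.

(** With [E] the backward shift, the difference operator is [1 - E], so the
    formula is the binomial expansion of [(1 - E) ^ p] applied to the sequence
    of differences of order [m - p].  The expansion is obtained by induction on
    [p] from Pascal's rule ([signed_binomial_sumS]). *)

(** Pascal's rule as one step of [(1 - E) ^ p.+1 = (1 - E) ^ p - E (1 - E) ^ p]: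
    here [E] acts by [y i |-> y (i - 1)]. *)
Lemma signed_binomial_sumS (A : pzRingType) (y : int -> A) (p : nat) (i : int) :
  \sum_(0 <= j < p.+2) (-1) ^+ j * 'C(p.+1, j)%:R * y (i - j%:Z) =
    \sum_(0 <= j < p.+1) (-1) ^+ j * 'C(p, j)%:R * y (i - j%:Z)
    - \sum_(0 <= j < p.+1) (-1) ^+ j * 'C(p, j)%:R * y (i - 1 - j%:Z).
Proof.
(* The first sum on the right may run up to [p.+1], as ['C(p, p.+1) = 0];
   both long sums then share the same term at [j = 0]. *)
have -> : \sum_(0 <= j < p.+1) (-1) ^+ j * 'C(p, j)%:R * y (i - j%:Z) =
          \sum_(0 <= j < p.+2) (-1) ^+ j * 'C(p, j)%:R * y (i - j%:Z).
  by rewrite [RHS]big_nat_recr //= bin_small // mulr0 mul0r addr0.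
rewrite big_nat_recl // [in RHS]big_nat_recl // !bin0 -addrA; congr (_ + _).
rewrite -sumrB; apply: eq_bigr => j _.
have -> : i - 1 - j%:Z = i - j.+1%:Z by rewrite intS opprD addrA.
by rewrite binS natrD mulrDr mulrDl [in X in _ + X]exprS mulN1r !mulNr.
Qed.

Lemma bdiff_addn (A : pzRingType) (x : int -> A) (k p : nat) (i : int) :
  bdiff (p + k) x i =
    \sum_(0 <= j < p.+1) (-1) ^+ j * 'C(p, j)%:R * bdiff k x (i - j%:Z).
Proof.
elim: p i => [|p IHp] i.
  by rewrite big_nat1 expr0 bin0 !mul1r subr0.
by rewrite signed_binomial_sumS -!IHp.
Qed.

Theorem theorem3p3 (R : realType) (m n p : nat) (hpm : (p <= m)%N)
    (x : int -> R[i]) :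
  bdiff m x n%:Z =
    \sum_(0 <= j < p.+1) (-1) ^+ j * 'C(p, j)%:R * bdiff (m - p) x (n%:Z - j%:Z).
Proof. by rewrite -bdiff_addn subnKC. Qed.
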